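(* Let $G$ be a finite group such that $\gamma(G)=2$ but $\gamma(G/N)>2$ for every nontrivial normal subgroup $N$ of $G$. Then $G$ has a unique minimal normal subgroup. Moreover, if $H$ and $K$ are two maximal subgroups of $G$ whose conjugates cover $G$, i.e. $G=\left(\bigcup_{x\in G}H^x\right)\cup\left(\bigcup_{y\in G}K^y\right)$, then either at least one of $H$ and $K$ contains $\mathrm{soc}(G)$, or $G$ is an almost simple group.
   Context: For a finite non-cyclic group $X$, $\gamma(X)$ denotes the normal covering number of $X$: the smallest integer $k$ such that $X$ contains $k$ proper subgroups $H_1,\dots,H_k$ with the property that every element of $X$ lies in $H_i^x$ for some $i\in\{1,\dots,k\}$ and $x\in X$ (where $H^x=x^{-1}Hx$). If $X$ is cyclic (including the trivial group), one sets $\gamma(X)=\infty$, with the convention $n<\infty$ for every integer $n$. The socle $\mathrm{soc}(G)$ is the subgroup generated by all minimal normal subgroups of $G$. A finite group $G$ is almost simple if $S\leq G\leq \mathrm{Aut}(S)$ (up to isomorphism, identifying $S$ with $\mathrm{Inn}(S)$) for some finite nonabelian simple group $S$. *)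

(* Defs.v *)
From mathcomp Require Import all_boot all_fingroup all_solvable.

Set Implicit Arguments.
Unset Strict Implicit.
Unset Printing Implicit Defensive.

Local Open Scope group_scope.

(* The subgroups H i need not be distinct: dropping repetitions from a covering
   family of size k gives a smaller one, so the least such k is unaffected. *)
Definition normal_covering (gT : finGroupType) (X : {group gT}) (k : nat) : bool :=
  [exists H : {ffun 'I_k -> {group gT}},
     [forall i, H i \proper X]
     && [forall g in X, exists i, exists x in X, g \in H i :^ x]].

Lemma normal_covering_ex (gT : finGroupType) (X : {group gT}) :
  ~ cyclic X -> exists k, normal_covering X k.
Proof.
move=> /negP ncX; exists #|gT|; apply/existsP.
exists [ffun i => if enum_val i \in X then [group of <[enum_val i : gT]>]
                  else [group of [1 gT]]].
apply/andP; split.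
  apply/forallP=> i; rewrite ffunE; case: ifP => [iX | _].
    rewrite properEneq cycle_subG iX andbT.
    by apply: contraNneq ncX => <-; apply: cycle_cyclic.
  by rewrite proper1G; apply: contraNneq ncX => ->; apply: cyclic1.
apply/forall_inP=> g gX; apply/existsP; exists (enum_rank g).
apply/exists_inP; exists 1; first exact: group1.
by rewrite conjsg1 ffunE enum_rankK gX /= cycle_id.
Qed.

(* Values of the normal covering number lie in nat extended by None = infinity. *)
Definition gamma (gT : finGroupType) (X : {group gT}) : option nat :=
  if @negP (cyclic X) is ReflectT ncX
  then Some (ex_minn (normal_covering_ex ncX)) else None.

Definition lt_ext (n : nat) (m : option nat) : bool :=
  if m is Some k then (n < k)%N else true.

(* minnormal N G only asks that G normalise N, not that N be contained in G. *)
Definition minimal_normal (gT : finGroupType) (N G : {group gT}) : bool :=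
  (N <| G) && minnormal N G.

Definition soc (gT : finGroupType) (G : {group gT}) : {set gT} :=
  << \bigcup_(N : {group gT} | minimal_normal N G) N >>.

(* conj_aut S @* S is Inn(S), as a subgroup of Aut S. *)
Definition almost_simple (gT : finGroupType) (G : {group gT}) : Prop :=
  exists (sT : finGroupType) (S : {group sT}) (A : {group {perm sT}}),
    [/\ simple S, ~~ abelian S, conj_aut S @* S \subset A, A \subset Aut S
      & G \isog A].

(* Main.v *)
Require Import Defs.
From mathcomp Require Import all_boot all_fingroup all_solvable.
From mathcomp Require Import zify.

Set Implicit Arguments.
Unset Strict Implicit.
Unset Printing Implicit Defensive.

Local Open Scope group_scope.

(* Two proper subgroups containing a common nontrivial normal subgroup cannot normally
   cover G, and by Jordan's theorem neither can one proper subgroup. Let H and K be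
   maximal with conjugates covering G. If M <> N are minimal normal and H contains
   neither, then H complements both, Jordan forces K to contain both, and this leads
   to another covering pair with a common normal subgroup; if H and K each contain exactly
   one of M and N, multiplying elements of M and N missed by K and H gives an uncovered
   element. So G has a unique minimal normal subgroup N. If neither H nor K contains N,
   look at a minimal normal subgroup T of N: either H :&: T = 1 or H :&: N does not
   project onto T, and likewise for K. Since N is covered, neither trivial
   intersection can occur, and two distinct choices of T would again yield an uncovered
   product; hence N is simple. It is nonabelian, as an abelian N would meet H and K
   trivially. *)

(** * Normal coverings by one or two proper subgroups *)

Section NormalCovers.

Variable gT : finGroupType.
Implicit Types (A B G H K L M N P : {group gT}).

(** Jordan's theorem by counting: [H] has at most [#|G : H|] conjugates, whose nonidentity elements
    number at most [#|G : H| * (#|H| - 1)], less than [#|G| - 1] when [H] is proper. *)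
Lemma class_support_proper H G :
  H \proper G -> exists2 g, g \in G & g \notin class_support H G.
Proof.
move=> /[dup] ltHG /proper_sub sHG; apply/subsetPn; apply: contraL ltHG => sGH.
have /eqP eqGH : class_support H G == G by rewrite eqEsubset class_support_subG.
have nH1H : H \subset 'N(H^#) by rewrite normD1 normG.
have le_conj : (#|H^# :^: G| <= #|G : H|)%N.
  by rewrite card_conjugates dvdn_leq ?indexg_gt0 // indexgS // subsetI sHG.
have := leq_card_cover (H^# :^: G); rewrite -class_supportD1 eqGH => -[+ _].
have -> : (\sum_(A in H^# :^: G) #|A| = #|H^# :^: G| * #|H^#|)%N.
  rewrite -sum_nat_const; apply: eq_bigr => _ /imsetP[x _ ->].
  by rewrite cardJg.
have cardD1 L : #|L^#| = #|L|.-1 by rewrite (cardsD1 1 L) group1.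
rewrite !{}cardD1 => le_card; rewrite properE sHG /= negbK -indexg_eq1.
have := leq_trans le_card (leq_mul le_conj (leqnn _)).
rewrite -(Lagrange sHG); move: (cardG_gt0 H) (indexg_gt0 G H).
case: #|H| => // h _; case: #|G : H| => // [[|i]] // _ /=.
by rewrite mulSn mulnC !mulSn; lia.
Qed.

Lemma class_support_supplement H N G :
  H * N = G -> class_support H G = class_support H N.
Proof. by move=> <-; rewrite class_supportM class_support_id. Qed.

(** The factorisation [G = H * N] reduces conjugation by [G] to conjugation by [N], which preserves
    [N]. *)
Lemma setI_class_support H N G :
  N <| G -> H * N = G -> N :&: class_support H G \subset class_support (N :&: H) N.
Proof.
move=> nsNG /class_support_supplement->; apply/subsetP=> y /setIP[yN].
rewrite !class_supportEr => /bigcupP[x xN yHx]; apply/bigcupP; exists x => //.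
by rewrite conjIg inE yHx conjGid ?yN.
Qed.

Lemma normal_not_covered H N G :
  N <| G -> H * N = G -> ~~ (N \subset H) ->
  exists2 x, x \in N & x \notin class_support H G.
Proof.
move=> nsNG defG nsNH; have [|x xN nx] := @class_support_proper (N :&: H)%G N.
  by rewrite properE subsetIl subsetI subxx.
exists x => //; apply: contra nx => xH.
by apply: (subsetP (setI_class_support nsNG defG)); rewrite inE xN.
Qed.


Lemma normal_covering2 H K G :
  H \proper G -> K \proper G ->
  G \subset class_support H G :|: class_support K G -> normal_covering G 2.
Proof.
move=> ltHG ltKG /subsetP cov; apply/existsP.
exists [ffun i : 'I_2 => if i == ord0 then H else K]; apply/andP; split.
  by apply/forallP=> i; rewrite ffunE; case: ifP.
apply/forall_inP=> g /cov; rewrite inE !class_supportEr.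
case/orP=> /bigcupP[x xG gx]; apply/existsP.
  by exists ord0; apply/exists_inP; exists x; rewrite ?ffunE.
by exists ord_max; apply/exists_inP; exists x; rewrite ?ffunE.
Qed.

Lemma normal_covering2P G :
  normal_covering G 2 -> exists H K,
  [/\ H \proper G, K \proper G & G \subset class_support H G :|: class_support K G].
Proof.
case/existsP=> F /andP[/forallP ltFG /forall_inP cov].
exists (F ord0), (F ord_max); split=> //; apply/subsetP=> g /cov.
case/existsP=> i /exists_inP[x xG gx]; rewrite inE !class_supportEr.
case: (unliftP ord0 i) gx => [j|] -> gx; apply/orP; [right | left]; apply/bigcupP.
  by exists x => //; rewrite (_ : ord_max = lift ord0 j) //; apply/val_inj; rewrite /= ord1.
by exists x.
Qed.

Lemma gamma_covering G k : gamma G = Some k -> normal_covering G k.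
Proof.
by rewrite /gamma; case: {-}_ / negP => // ncG [<-]; case: ex_minnP.
Qed.

Lemma gamma_le G k : ~~ cyclic G -> normal_covering G k -> ~~ lt_ext k (gamma G).
Proof.
move=> /negP ncG covG; rewrite /gamma; case: {-}_ / negP => //= ncG'.
by case: ex_minnP => m _ /(_ k covG); rewrite -leqNgt.
Qed.

Lemma cyclic_not_covered H K G :
  H \proper G -> K \proper G -> cyclic G ->
  ~~ (G \subset class_support H G :|: class_support K G).
Proof.
move=> ltHG ltKG /cyclicP[a defG]; apply/subsetPn; exists a.
  by rewrite defG cycle_id.
have not_in L : L \proper G -> a \notin class_support L G.
  move=> /[dup] ltLG /proper_sub sLG; rewrite class_supportEr.
  apply/bigcupP=> -[x xG]; rewrite (normsP _ x xG).
    by rewrite -cycle_subG -defG; apply/negP/proper_subn.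
  by apply: sub_abelian_norm => //; rewrite defG cycle_abelian.
by rewrite inE negb_or !not_in.
Qed.

End NormalCovers.

(** * Minimal normal subgroups and their supplements *)

Section MinimalNormal.

Variable gT : finGroupType.
Implicit Types (G H K L M N P S : {group gT}).

Lemma quotient_not_covered H K N G :
    N <| G -> lt_ext 2 (gamma (G / N)%G) ->
    H \proper G -> K \proper G -> N \subset H -> N \subset K ->
  ~~ (G \subset class_support H G :|: class_support K G).
Proof.
move=> nsNG gtG ltHG ltKG sNH sNK; apply: contraL gtG => /subsetP cov.
have ltq L : L \proper G -> N \subset L -> (L / N)%G \proper (G / N)%G.
  move=> ltLG sNL; rewrite quotient_proper //.
  exact: normalS sNL (proper_sub ltLG) nsNG.
have covq : (G / N)%G \subset class_support (H / N)%G (G / N)%G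
                          :|: class_support (K / N)%G (G / N)%G.
  apply/subsetP=> _ /morphimP[g Ng gG ->].
  have memq L x y : L \subset G -> x \in L -> y \in G ->
    coset N (x ^ y) \in class_support (L / N) (G / N).
    move=> sLG xL yG; have nNG := subsetP (normal_norm nsNG).
    rewrite (morphJ _ (nNG _ (subsetP sLG x xL)) (nNG _ yG)).
    exact: (memJ_class_support (mem_quotient N xL) (mem_quotient N yG)).
  case/setUP: (cov g gG) => /imset2P[u v uL vG ->]; rewrite inE.
    by rewrite memq // proper_sub.
  by rewrite orbC memq // proper_sub.
apply: gamma_le; last exact: normal_covering2 (ltq H _ _) (ltq K _ _) covq.
(* A cyclic quotient would have infinite [gamma], but the covering itself excludes this case. *)
by apply: contraL covq; apply: cyclic_not_covered; apply: ltq.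
Qed.

Lemma maximal_supplement H N G :
  maximal H G -> N <| G -> ~~ (N \subset H) -> H * N = G.
Proof.
move/maxgroupP=> [ltHG maxH] nsNG; apply: contraNeq => neG.
have sHG := proper_sub ltHG; have nNH := subset_trans sHG (normal_norm nsNG).
have ltHNG : (H <*> N)%G \proper G.
  by rewrite properEneq /= norm_joinEl // neG mul_subG ?(normal_sub nsNG).
by rewrite -(maxH _ ltHNG) ?joing_subl ?joing_subr.
Qed.

Lemma minimal_normal_eq M L G :
  minimal_normal M G -> L \subset M -> L != 1 :> {set gT} -> G \subset 'N(L) ->
  L :=: M.
Proof.
case/andP=> _ /mingroupP[_ minM] sLM ntL nLG.
by apply: minM => //; rewrite ntL.
Qed.

Lemma normal_TI_cents M N G :
  M <| G -> N <| G -> M :&: N = 1 -> M \subset 'C(N).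
Proof.
case/andP=> sMG nMG /andP[sNG nNG] tiMN; apply/commG1P/trivgP; rewrite -tiMN.
by rewrite commg_subI // subsetI subxx (subset_trans _ nMG, subset_trans _ nNG).
Qed.

Lemma minimal_normal_TI M N G :
  minimal_normal M G -> minimal_normal N G -> M != N -> M :&: N = 1.
Proof.
move=> minM minN; apply: contraNeq => ntMN.
have nI : G \subset 'N(M :&: N).
  by case/andP: minM minN => /andP[_ ? _] /andP[/andP[_ ?] _]; rewrite normsI.
have eqM := minimal_normal_eq (L := (M :&: N)%G) minM (subsetIl _ _) ntMN nI.
have eqN := minimal_normal_eq (L := (M :&: N)%G) minN (subsetIr _ _) ntMN nI.
by apply/eqP/val_inj; rewrite /= -eqM eqN.
Qed.

(** The intersection [H :&: M] is normalised by [H] and centralised by [N], hence normal in [G], and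
    minimality of [M] applies. *)
Lemma supplement_commuting_TI H M N G :
    minimal_normal M G -> N \subset 'C(M) -> H * N = G -> ~~ (M \subset H) ->
  H :&: M = 1.
Proof.
move=> minM cMN defG; apply: contraNeq => ntHM.
have nMG : G \subset 'N(M) by case/andP: minM => /andP[].
have sHG : H \subset G by rewrite -defG mulG_subl.
have nHM : G \subset 'N(H :&: M).
  rewrite -defG mul_subG //; first by rewrite normsI ?normG ?(subset_trans sHG).
  exact: cents_norm (subset_trans cMN (centS (subsetIr H M))).
by rewrite -(minimal_normal_eq (L := (H :&: M)%G) minM (subsetIr _ _) ntHM nHM) subsetIl.
Qed.

Lemma complement_class_support H M G :
  M <| G -> H * M = G -> H :&: M = 1 -> M :&: class_support H G \subset [1 gT].
Proof.
move=> nsMG defG tiHM; apply: subset_trans (setI_class_support nsMG defG) _.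
by rewrite setIC tiHM class_support_set1l class1G.
Qed.

(* Write [m = d * n] with [d] in [H] and [n] in [N]. Then [h * n^-1] lies in [H :^ x]
   for some [x] in [M]; comparing it with [h * m * n^-1 = h * d] gives [m = [~ h, x^-1]]. *)
Lemma common_complement_class H M N G (h m : gT) :
    M <| G -> N \subset 'C(M) -> H * M = G -> H * N = G -> H :&: M = 1 ->
    h \in H -> {in N, forall n, h * n \in class_support H G} -> m \in M ->
  exists2 x, x \in M & h * m = h ^ x.
Proof.
move=> nsMG cMN defGM defGN tiHM hH hN mM.
have mG := subsetP (normal_sub nsMG) m mM.
have := mG; rewrite -defGN => /mulsgP[d n dH nN def_m].
have := hN _ (groupVr nN); rewrite (class_support_supplement defGM) class_supportEr.
case/bigcupP=> x xM; rewrite mem_conjg => hnH; exists x^-1; rewrite ?groupV //.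
have cnx : n^-1 ^ x^-1 = n^-1.
  apply/conjg_fixP/commgP.
  by apply: (centP (subsetP cMN _ (groupVr nN))); rewrite groupV.
move: hnH; rewrite conjMg {}cnx => hnH.
have hG : h \in 'N(M).
  apply: (subsetP (normal_norm nsMG)).
  by apply: (subsetP _ _ hH); rewrite -defGM mulG_subl.
have cM : [~ h, x^-1] \in M.
  by rewrite commgEr groupMl ?groupVr ?memJ_norm ?groupV.
suffices <- : [~ h, x^-1] = m by rewrite -conjg_mulR.
(* The quotient of the two sides lies in [M]. It lies in [H] too: multiplying it by [h] on the left
   and by [d] on the right gives [h ^ x^-1 * n^-1]. *)
apply/eqP; rewrite eq_mulgV1 -in_set1 -[[set 1]]tiHM inE andbC groupM ?groupV //=.
by rewrite def_m invMg mulgA groupMr ?groupV // -(groupMl _ hH) mulgA -conjg_mulR.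
Qed.

(** If [P] were normal in [G], minimality would give [P = M]; then [M] is nilpotent, its nontrivial
    centre is all of [M], and [M] is abelian. *)
Lemma minimal_normal_Sylow_norm_proper M P G p :
  minimal_normal M G -> ~~ abelian M -> p \in \pi(M) -> p.-Sylow(M) P ->
  'N_G(P) \proper G.
Proof.
move=> minM nabM piMp sylP; rewrite properE subsetIl subsetI subxx /=.
apply: contra nabM => nPG; have sPM := pHall_sub sylP.
have ntP : P :!=: 1 by rewrite -rank_gt0 (rank_Sylow sylP) p_rank_gt0.
have eqP := minimal_normal_eq minM sPM ntP nPG.
have nilM : nilpotent M by rewrite -eqP (pgroup_nil (pHall_pgroup sylP)).
have /andP[nsMG /mingroupP[/andP[ntM _] _]] := minM.
apply/center_idP/(minimal_normal_eq (L := 'Z(M)%G) minM (center_sub M)).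
  by rewrite center_nil_eq1.
exact: normal_norm (char_normal_trans (center_char M) nsMG).
Qed.

(** * Covering pairs in the presence of two minimal normal subgroups *)

Section TwoMinimalNormal.

Variables G H K : {group gT}.
Hypothesis gammaQ : forall N : {group gT},
  N <| G -> N :!=: 1 -> lt_ext 2 (gamma (G / N)%G).
Hypotheses (maxH : maximal H G) (maxK : maximal K G).
Hypothesis covG : G \subset class_support H G :|: class_support K G.

Lemma not_both_contain N : N <| G -> N :!=: 1 -> N \subset H -> ~~ (N \subset K).
Proof.
move=> nsNG ntN sNH; apply: contraL covG => sNK.
by apply: (quotient_not_covered nsNG) => //;
  [exact: gammaQ | exact: maxgroupp maxH | exact: maxgroupp maxK].
Qed.

Lemma minimal_normal_normal M : minimal_normal M G -> M <| G /\ M :!=: 1.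
Proof. by case/andP=> nsMG /mingroupP[/andP[]]. Qed.

(* If [M] is abelian, the diagonal [H :&: (M <*> N)] is normal in [G] and lies in [H]
   and [K]. Otherwise let [P] be a Sylow subgroup of [M]. For [h] outside the conjugates
   of [K], the coset [h * M] is a single [M]-class and by Frattini it meets ['N_G(P)],
   so ['N_G(P)] and [K], which both contain [N], cover [G] up to conjugation. *)
Lemma no_common_complement M N :
  minimal_normal M G -> minimal_normal N G -> M != N ->
  ~~ (M \subset H) -> ~~ (N \subset H) -> ~~ ((M \subset K) && (N \subset K)).
Proof.
move=> minM minN neMN nsMH nsNH; apply/negP=> /andP[sMK sNK].
have [[nsMG ntM] [nsNG ntN]] := (minimal_normal_normal minM, minimal_normal_normal minN).
have tiMN := minimal_normal_TI minM minN neMN.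
have cMN : N \subset 'C(M) by rewrite centsC (normal_TI_cents nsMG nsNG).
have defGM := maximal_supplement maxH nsMG nsMH.
have defGN := maximal_supplement maxH nsNG nsNH.
have tiHM := supplement_commuting_TI minM cMN defGN nsMH.
have [sHG _] := andP (maxgroupp maxH).
have [abM | nabM] := boolP (abelian M).
  pose D := (H :&: (M <*> N))%G.
  have cDM : D \subset 'C(M).
    by apply: subset_trans (subsetIr _ _) _; rewrite join_subG -/(abelian M) abM.
  have nDG : G \subset 'N(D).
    rewrite -defGM mul_subG //; last by rewrite cents_norm // centsC.
    by rewrite normsI ?normG // normsY ?(subset_trans sHG) ?normal_norm.
  have ntD : D :!=: 1.
    apply: contraNneq ntN => D1; rewrite -subG1 -tiMN subsetI subxx andbT.
    apply/subsetP=> n nN; have := subsetP (normal_sub nsNG) n nN.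
    rewrite -defGM => /mulsgP[h m hH mM def_n].
    suffices: h \in D by rewrite D1 inE => /eqP h1; rewrite def_n h1 mul1g.
    rewrite inE hH -(mulgK m h) -def_n groupM ?groupV //.
      exact: (subsetP (joing_subr M N)).
    exact: (subsetP (joing_subl M N)).
  have sDK : D \subset K.
    by apply: subset_trans (subsetIr _ _) _; rewrite join_subG sMK.
  suffices: ~~ (D \subset K) by rewrite sDK.
  apply: not_both_contain => //; last exact: subsetIl.
  by rewrite /normal nDG (subset_trans (subsetIl _ _)).
pose p := pdiv #|M|; have [P sylP] := Sylow_exists p M.
have piMp : p \in \pi(M) by rewrite pi_pdiv cardG_gt1.
have ltRG := minimal_normal_Sylow_norm_proper minM nabM piMp sylP.
have sNR : N \subset 'N_G(P).
  rewrite subsetI normal_sub //= cents_norm //.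
  exact: subset_trans cMN (centS (pHall_sub sylP)).
suffices covR : G \subset class_support 'N_G(P)%G G :|: class_support K G.
  move: covR; apply/negP; apply: (quotient_not_covered nsNG) => //.
    exact: gammaQ.
  exact: maxgroupp maxK.
apply/subsetP=> g gG; rewrite inE orbC -implyNb; apply/implyP=> gK.
have /setUP[] := subsetP covG g gG; last by rewrite (negPf gK).
case/imset2P=> h y hH yG def_g.
have hG := subsetP sHG h hH; have nRG := class_support_norm 'N_G(P) G.
rewrite {}def_g (memJ_norm _ (subsetP (class_support_norm K G) y yG)) in gK *.
rewrite (memJ_norm _ (subsetP nRG y yG)).
(* A conjugate of [K] containing [h * n] also contains [n], hence [h], which was assumed missed by
   [K]. *)
have hN : {in N, forall n, h * n \in class_support H G}.
  move=> n nN; have nG := subsetP (normal_sub nsNG) n nN.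
  have /setUP[] // := subsetP covG _ (groupM hG nG).
  rewrite class_supportEr => /bigcupP[z zG hnKz]; case/negP: gK.
  rewrite class_supportEr; apply/bigcupP; exists z => //.
  have nKz : n \in K :^ z.
    apply: (subsetP _ n nN).
    by rewrite -(normsP (normal_norm nsNG) z zG) conjSg.
  by rewrite -(mulgK n h) groupM ?groupV.
move: (hG); rewrite -{1}(Frattini_arg nsMG sylP) => /mulsgP[m r mM rR def_h].
(* This choice gives [h * m^-1 ^ h = m^-1 * h = r], so [r] becomes a conjugate of [h]. *)
have mhM : m^-1 ^ h \in M by rewrite memJ_norm ?groupV // (subsetP (normal_norm nsMG)).
have [x xM] := common_complement_class nsMG cMN defGM defGN tiHM hH hN mhM.
rewrite -conjgC {1}def_h mulKg => def_r.
rewrite -(memJ_norm _ (subsetP nRG x (subsetP (normal_sub nsMG) x xM))) -def_r.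
exact: mem_class_support.
Qed.

(** Conjugates of [H] meet [M] only in the identity, so those of [K] must cover [M]; Jordan's
    theorem forbids this when [M :&: K] is proper in [M]. *)
Lemma complement_sub M :
  M <| G -> H :&: M = 1 -> ~~ (M \subset H) -> M \subset K.
Proof.
move=> nsMG tiHM nsMH; apply: contraT => nsMK.
have defG := maximal_supplement maxH nsMG nsMH.
have [x xM nxK] := normal_not_covered nsMG (maximal_supplement maxK nsMG nsMK) nsMK.
have := subsetP covG x (subsetP (normal_sub nsMG) x xM).
rewrite inE (negPf nxK) orbF => xH; case/negP: nxK.
suffices /set1P-> : x \in [1 gT] by rewrite mem_class_support.
by apply: (subsetP (complement_class_support nsMG defG tiHM)); rewrite inE xM.
Qed.

Lemma one_sub_of_two_minimal_normal M N :
  minimal_normal M G -> minimal_normal N G -> M != N ->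
  (M \subset H) || (N \subset H).
Proof.
move=> minM minN neMN; rewrite -[_ || _]negbK negb_or; apply/negP=> /andP[nsMH nsNH].
have [[nsMG _] [nsNG _]] := (minimal_normal_normal minM, minimal_normal_normal minN).
have tiMN := minimal_normal_TI minM minN neMN.
have cMN := normal_TI_cents nsMG nsNG tiMN.
case/negP: (no_common_complement minM minN neMN nsMH nsNH).
have defGM := maximal_supplement maxH nsMG nsMH.
have defGN := maximal_supplement maxH nsNG nsNH.
rewrite !complement_sub //; first exact: supplement_commuting_TI minN cMN defGM nsNH.
by apply: (supplement_commuting_TI minM _ defGN nsMH); rewrite centsC.
Qed.

Lemma not_crossed M N :
  M <| G -> N <| G -> M :&: N = 1 ->
  M \subset H -> N \subset K -> (M \subset K) || (N \subset H).
Proof.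
move=> nsMG nsNG tiMN sMH sNK; rewrite -[_ || _]negbK negb_or.
apply/negP=> /andP[nsMK nsNH].
have [sMG sNG] := (normal_sub nsMG, normal_sub nsNG).
have [m mM nmK] := normal_not_covered nsMG (maximal_supplement maxK nsMG nsMK) nsMK.
have [n nN nnH] := normal_not_covered nsNG (maximal_supplement maxH nsNG nsNH) nsNH.
have sub_conj L (B : {group gT}) x : L <| G -> L \subset B -> x \in G -> L \subset B :^ x.
  by move=> nsLG sLB xG; rewrite -(normsP (normal_norm nsLG) x xG) conjSg.
have := subsetP covG (m * n).
rewrite groupM ?(subsetP sMG m) ?(subsetP sNG n) // => /(_ isT) /setUP[];
  rewrite class_supportEr => /bigcupP[x xG mnx].
  case/negP: nnH; rewrite class_supportEr; apply/bigcupP; exists x => //.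
  by rewrite -(groupMl n (subsetP (sub_conj _ _ _ nsMG sMH xG) m mM)).
case/negP: nmK; rewrite class_supportEr; apply/bigcupP; exists x => //.
by rewrite -(groupMr m (subsetP (sub_conj _ _ _ nsNG sNK xG) n nN)).
Qed.

End TwoMinimalNormal.

(** Each of [H] and [K] contains [M] or [N], and neither [M] nor [N] lies in both. What remains is
    the crossed configuration, excluded by [not_crossed]. *)
Lemma minimal_normal_unique G H K :
    (forall N, N <| G -> N :!=: 1 -> lt_ext 2 (gamma (G / N)%G)) ->
    maximal H G -> maximal K G ->
    G \subset class_support H G :|: class_support K G ->
  forall M N, minimal_normal M G -> minimal_normal N G -> M = N.
Proof.
move=> gQ maxH maxK covG M N minM minN; apply/eqP; apply: contraT => neMN.
have covG' : G \subset class_support K G :|: class_support H G by rewrite setUC.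
have [[nsMG ntM] [nsNG ntN]] := (minimal_normal_normal minM, minimal_normal_normal minN).
have tiMN := minimal_normal_TI minM minN neMN.
have H1 := one_sub_of_two_minimal_normal gQ maxH maxK covG minM minN neMN.
have K1 := one_sub_of_two_minimal_normal gQ maxK maxH covG' minM minN neMN.
have MHK := not_both_contain gQ maxH maxK covG nsMG ntM.
have NHK := not_both_contain gQ maxH maxK covG nsNG ntN.
have C1 := not_crossed maxH maxK covG nsMG nsNG tiMN.
have C2 := not_crossed maxK maxH covG' nsMG nsNG tiMN.
case: (boolP (M \subset H)) H1 MHK C1 C2 => [_ _ /(_ isT) nMK | _ /= NH _ _].
  move: K1; rewrite (negPf nMK) /= => NK /(_ isT NK) /= NH _.
  by rewrite NK in NHK; case/negP: (NHK NH).
move: K1; by rewrite (negPf (NHK NH)) orbF => MK /(_ MK NH).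
Qed.

Lemma minimal_normalJ S N x :
  x \in 'N(N) -> minimal_normal S N -> minimal_normal (S :^ x)%G N.
Proof.
move=> /normP nNx /andP[nsSN /mingroupP[/andP[ntS nSN] minS]].
have nSxN : N \subset 'N(S :^ x) by rewrite normJ -{1}nNx conjSg.
apply/andP; split; first by rewrite -nNx /= /normal normJ !conjSg.
apply/mingroupP; split=> [|L /andP[ntL nLN] sLS].
  by rewrite nSxN andbT trivg_card1 cardJg -trivg_card1.
rewrite /= -(minS (L :^ x^-1)%G) /= ?conjsgKV ?sub_conjgV //.
rewrite trivg_card1 cardJg -trivg_card1 ntL normJ -sub_conjg.
by rewrite nNx.
Qed.

Lemma minimal_normal_generate S N G :
  minimal_normal N G -> S \subset N -> S :!=: 1 -> <<class_support S G>> = N.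
Proof.
move=> minN sSN ntS; have [/andP[_ nNG] _] := minimal_normal_normal minN.
apply: (minimal_normal_eq (L := <<class_support S G>>%G) minN).
- by rewrite gen_subG class_support_sub_norm.
- apply: subG1_contra ntS; exact: subset_trans (sub_class_support _ _) (subset_gen _).
by rewrite norms_gen ?class_support_norm.
Qed.

End MinimalNormal.

(** * Simple factors of a minimal normal subgroup *)

Section Factors.

Variables (gT : finGroupType) (G N : {group gT}).
Implicit Types H K S T L : {group gT}.
Hypothesis minN : minimal_normal N G.

Let nsNG : N <| G. Proof. by case: (minimal_normal_normal minN). Qed.

(** The conjugates of [T] generate [N], and each one other than [T] centralises [T]. This splitting
    replaces a full decomposition of [N] into simple factors. *)
Lemma minimal_normal_factor T :
  minimal_normal T N -> N \subset T <*> 'C_N(T).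
Proof.
move=> minT; have [/andP[sTN nTN] ntT] := minimal_normal_normal minT.
rewrite -{1}(minimal_normal_generate minN sTN ntT) gen_subG class_supportEr.
apply/bigcupsP=> x xG; have Nx := subsetP (normal_norm nsNG) x xG.
have minTx := minimal_normalJ Nx minT.
have [<- | neT] := eqVneq (T : {set gT}) (T :^ x); first exact: joing_subl.
have [nsTx _] := minimal_normal_normal minTx.
apply: subset_trans (joing_subr _ _); rewrite subsetI (normal_sub nsTx).
have [nsT _] := minimal_normal_normal minT.
by rewrite (normal_TI_cents nsTx nsT) // setIC (minimal_normal_TI minT minTx).
Qed.

Lemma factor_simple T : minimal_normal T N -> simple T.
Proof.
move=> minT; have [/andP[sTN nTN] ntT] := minimal_normal_normal minT.
apply/simpleP; split=> // L /andP[sLT nLT].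
have [-> | ntL] := eqVneq (L : {set gT}) 1; [by left | right].
apply: (minimal_normal_eq minT) => //.
apply: subset_trans (minimal_normal_factor minT) _.
rewrite join_subG nLT cents_norm // centsC.
by apply: subset_trans sLT _; rewrite centsC subsetIr.
Qed.

(** If [N :&: H] projects onto [T], then [N] normalises [H :&: T], which is thus [1] or [T]. If it
    is [T], then [H] contains all conjugates of [T] under [G = N * H], since [N] fixes [T]; these
    generate [N]. *)
Lemma factor_dichotomy H T :
    H \subset G -> H * N = G -> ~~ (N \subset H) -> minimal_normal T N ->
  H :&: T = 1 \/ (N :&: H) <*> 'C_N(T) \proper N.
Proof.
move=> sHG defG nsNH minT; have [nsTN ntT] := minimal_normal_normal minT.
have [sTN nTN] := andP nsTN.
have [-> | ntHT] := eqVneq (H :&: T) 1; [by left | right].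
rewrite properE join_subG !subsetIl /=; apply: contra nsNH => sNA.
have nHT : N \subset 'N(H :&: T).
  apply: subset_trans sNA _; rewrite join_subG; apply/andP; split.
    apply: normsI; first exact: subset_trans (subsetIr N H) (normG H).
    exact: subset_trans (subsetIl N H) nTN.
  by rewrite cents_norm // (subset_trans (subsetIr _ _)) ?centS ?subsetIr.
have eqT := minimal_normal_eq (L := (H :&: T)%G) minT (subsetIr _ _) ntHT nHT.
rewrite -(minimal_normal_generate minN sTN ntT) gen_subG -defG.
have sTH : T \subset H by rewrite -eqT subsetIl.
rewrite (normC (subset_trans sHG (normal_norm nsNG))) class_supportM.
apply: class_support_sub_norm (normG H); apply: subset_trans sTH.
exact: class_support_sub_norm.
Qed.

(* The coset [t * C_N(T)] is the set of elements of [N] whose projection on the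
   direct factor [T] is [t]. *)
Lemma factor_not_covered H T :
    H * N = G -> (N :&: H) <*> 'C_N(T) \proper N -> minimal_normal T N ->
  exists2 t, t \in T & {in 'C_N(T), forall c, t * c \notin class_support H G}.
Proof.
move=> defG ltAN minT; have [x xN nx] := class_support_proper ltAN.
have [nsTN _] := minimal_normal_normal minT; have [sTN nTN] := andP nsTN.
have nTC : T \subset 'N('C_N(T)).
  by rewrite normsI ?(subset_trans sTN) ?normG // norms_cent ?normG.
have := subsetP (minimal_normal_factor minT) x xN.
rewrite norm_joinEl // => /mulsgP[t c tT cC def_x]; exists t => // d dC.
apply: contra nx => tdH.
have tdN : t * d \in N by exact: groupM (subsetP sTN t tT) (subsetP (subsetIl N _) d dC).
have := subsetP (setI_class_support nsNG defG) (t * d).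
rewrite inE tdN tdH => /(_ isT); rewrite !class_supportEr => /bigcupP[n nN tdn].
apply/bigcupP; exists n => //; rewrite def_x /=.
(* Every [N]-conjugate of the join contains ['C_N(T)], so whether it contains [t * d] does not
   depend on [d]. *)
have sCA : 'C_N(T) \subset ((N :&: H) <*> 'C_N(T)) :^ n.
  have nCN : n \in 'N('C_N(T)).
    by apply: (subsetP _ n nN); rewrite normsI ?normG ?norms_cent.
  by rewrite -{1}(normP nCN) conjSg joing_subr.
have tdA : t * d \in ((N :&: H) <*> 'C_N(T)) :^ n.
  by apply: subsetP tdn; rewrite conjSg joing_subl.
by rewrite (groupMr t (subsetP sCA c cC)) -(groupMr t (subsetP sCA d dC)).
Qed.

Lemma factor_TI_not_covered H T t :
    H * N = G -> H :&: T = 1 -> T <| N -> t \in T -> t != 1 ->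
  t \notin class_support H G.
Proof.
move=> defG tiHT /andP[sTN nTN] tT; apply: contra => tH; rewrite -in_set1.
have := subsetP (setI_class_support nsNG defG) t.
rewrite in_setI (subsetP sTN) // tH => /(_ isT); rewrite class_supportEr.
case/bigcupP=> n nN; rewrite conjIg => /setIP[_ tHn].
by rewrite -[[set 1]](conjs1g n) -tiHT conjIg inE tHn (normsP nTN).
Qed.

(** If [H :&: T = 1], conjugates of [K] must cover [T]. This fails both when [K :&: T = 1] and when
    [N :&: K] does not project onto [T]. *)
Lemma factor_proper H K T :
    H \subset G -> K \subset G -> H * N = G -> K * N = G ->
    ~~ (N \subset H) -> ~~ (N \subset K) ->
    N \subset class_support H G :|: class_support K G ->
    minimal_normal T N ->
  (N :&: H) <*> 'C_N(T) \proper N.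
Proof.
move=> sHG sKG defGH defGK nsNH nsNK /subsetP covN minT.
have [nsTN ntT] := minimal_normal_normal minT; have sTN := normal_sub nsTN.
have [tiHT |//] := factor_dichotomy sHG defGH nsNH minT.
have notK t : t \in T -> t != 1 -> t \in class_support K G.
  move=> tT nt1; have /setUP[] // := covN t (subsetP sTN t tT).
  by rewrite (negPf (factor_TI_not_covered defGH tiHT nsTN tT nt1)).
have [tiKT | ltKN] := factor_dichotomy sKG defGK nsNK minT.
  have [t tT nt1] := trivgPn _ ntT.
  by case/negP: (factor_TI_not_covered defGK tiKT nsTN tT nt1); apply: notK.
have [t tT ntK] := factor_not_covered defGK ltKN minT.
have := ntK 1 (group1 _); rewrite mulg1 => {}ntK.
case/negP: (ntK); apply: notK => //.
by apply: contraNneq ntK => ->; apply: mem_class_support.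
Qed.

(* With two distinct simple factors [S] and [T], elements [t] of [S] and [u] of [T]
   whose cosets by the complementary factors avoid the conjugates of [H] and of [K]
   respectively give an uncovered element [t * u]. *)
Lemma covered_simple H K :
    H \subset G -> K \subset G -> H * N = G -> K * N = G ->
    ~~ (N \subset H) -> ~~ (N \subset K) ->
    N \subset class_support H G :|: class_support K G ->
  simple N.
Proof.
move=> sHG sKG defGH defGK nsNH nsNK covN.
have [_ ntN] := minimal_normal_normal minN.
have [S minS0 sSN] := minnormal_exists ntN (normG N).
have minS : minimal_normal S N.
  rewrite /minimal_normal minS0 andbT /normal sSN.
  by have /mingroupP[/andP[]] := minS0.
have [-> | neSN] := eqVneq N S; first exact: factor_simple minS.
have [_ ntS] := minimal_normal_normal minS.
(* If [G] fixed [S] under conjugation, minimality of [N] would give [S = N]. *)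
have [g gG neSg] : exists2 g, g \in G & S :^ g != S.
  apply/exists_inP; rewrite -[[exists _ in _, _]]negbK negb_exists_in.
  apply: contra neSN => /forall_inP SJ; rewrite eq_sym.
  apply/eqP/val_inj/(minimal_normal_eq minN) => //.
  by apply/normsP=> x /SJ /negPn/eqP.
have minT := minimal_normalJ (subsetP (normal_norm nsNG) g gG) minS.
set T := (S :^ g)%G in minT.
have [[nsSN _] [nsTN _]] := (minimal_normal_normal minS, minimal_normal_normal minT).
have [sTN _] := andP nsTN.
have cTS : T \subset 'C(S).
  by rewrite (normal_TI_cents nsTN nsSN) ?(minimal_normal_TI minT minS).
have ltH := factor_proper sHG sKG defGH defGK nsNH nsNK covN minS.
have covN' : N \subset class_support K G :|: class_support H G by rewrite setUC.
have ltK := factor_proper sKG sHG defGK defGH nsNK nsNH covN' minT.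
have [t tS ntH] := factor_not_covered defGH ltH minS.
have [u uT nuK] := factor_not_covered defGK ltK minT.
have cuS := subsetP cTS u uT.
have [tN uN] := (subsetP sSN t tS, subsetP sTN u uT).
have ntuH : t * u \notin class_support H G by apply: ntH; rewrite inE uN.
have ntuK : t * u \notin class_support K G.
  by rewrite -(centP cuS) // nuK // inE tN (subsetP _ t tS) // centsC.
by have := subsetP covN _ (groupM tN uN); rewrite inE (negPf ntuH) (negPf ntuK).
Qed.

End Factors.

(** * Almost simplicity and the final assembly *)

Lemma almost_simple_of_simple_normal (gT : finGroupType) (G N : {group gT}) :
  N <| G -> simple N -> ~~ abelian N -> 'C_G(N) = 1 -> almost_simple G.
Proof.
move=> nsNG simN nabN C1; have [sNG nNG] := andP nsNG.
exists gT, N, (conj_aut N @* G)%G; split=> //; first exact: morphimS.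
  exact: Aut_conj_aut.
(* The kernel of the conjugation action of [G] on [N] is ['C_G(N)]. *)
have := first_isog_loc (conj_aut N) nNG.
rewrite ker_conj_aut C1; apply: isog_trans; exact: quotient1_isog.
Qed.

Theorem theorem5 (gT : finGroupType) (G : {group gT})
    (gammaG : gamma G = Some 2)
    (gammaQ : forall N : {group gT},
       N <| G -> N :!=: 1 -> lt_ext 2 (gamma (G / N)%G)) :
  (exists! N : {group gT}, minimal_normal N G)
  /\ (forall H K : {group gT},
        maximal H G -> maximal K G ->
        G :=: (\bigcup_(x in G) H :^ x) :|: (\bigcup_(y in G) K :^ y) ->
        (soc G \subset H \/ soc G \subset K) \/ almost_simple G).
Proof.
have [H0 [K0 [ltH0 ltK0 cov0]]] := normal_covering2P (gamma_covering gammaG).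
have sub_max (L : {group gT}) :
    L \proper G -> exists2 M : {group gT}, maximal M G & L \subset M.
  move=> ltLG; have [eqLG | //] := maximal_exists (proper_sub ltLG).
  by rewrite eqLG properxx in ltLG.
have [[H1 maxH1 sH01] [K1 maxK1 sK01]] := (sub_max H0 ltH0, sub_max K0 ltK0).
have cov1 : G \subset class_support H1 G :|: class_support K1 G.
  apply: subset_trans cov0 _; rewrite !class_supportEr setUSS //.
    by apply/bigcupsP=> x xG; apply: bigcup_max xG _; rewrite conjSg.
  by apply/bigcupsP=> x xG; apply: bigcup_max xG _; rewrite conjSg.
have uniqN := minimal_normal_unique gammaQ maxH1 maxK1 cov1.
have min_exists (L : {group gT}) : L <| G -> L :!=: 1 ->
    exists2 M : {group gT}, minimal_normal M G & M \subset L.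
  case/andP=> sLG nLG ntL; have [M minM sML] := minnormal_exists ntL nLG.
  exists M => //; rewrite /minimal_normal minM andbT /normal (subset_trans sML) //.
  by have /mingroupP[/andP[]] := minM.
have ntG : G :!=: 1.
  by apply: contraTneq ltH0 => ->; rewrite properE sub1G andbF.
have [N minN _] := min_exists G (normal_refl G) ntG.
split; first by exists N; split=> // M; apply: uniqN.
move=> H K maxH maxK defG.
have covG : G \subset class_support H G :|: class_support K G.
  by rewrite !class_supportEr -defG.
have socN : soc G \subset N.
  by rewrite gen_subG; apply/bigcupsP=> M minM; rewrite (uniqN M N).
have [sNH | nsNH] := boolP (N \subset H).
  by left; left; apply: subset_trans sNH.
have [sNK | nsNK] := boolP (N \subset K).
  by left; right; apply: subset_trans sNK.
have [nsNG ntN] := minimal_normal_normal minN; right.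
have [[sHG _] [sKG _]] := (andP (maxgroupp maxH), andP (maxgroupp maxK)).
have defGH := maximal_supplement maxH nsNG nsNH.
have nabN : ~~ abelian N.
  (* An abelian [N] centralises itself, so it serves as its own commuting supplement: [H :&: N = 1],
     which forces [N] into [K]. *)
  apply: contra nsNK => abN; apply: (complement_sub maxH maxK covG nsNG) => //.
  exact: supplement_commuting_TI minN abN defGH nsNH.
apply: (almost_simple_of_simple_normal nsNG _ nabN).
  apply: (covered_simple minN sHG sKG defGH _ nsNH nsNK).
    exact: maximal_supplement maxK nsNG nsNK.
  exact: subset_trans (normal_sub nsNG) covG.
(* A nontrivial ['C_G(N)] would contain a minimal normal subgroup of [G]; by uniqueness this is [N],
   which would then be abelian. *)
apply/eqP; apply: contraNT nabN => ntC.
have [|M minM sMC] := min_exists 'C_G(N)%G _ ntC.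
  by rewrite /normal subsetIl normsI ?normG ?norms_cent ?normal_norm.
by rewrite (uniqN M N) // in sMC; apply: subset_trans sMC (subsetIr _ _).
Qed.
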